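(* Let $n\ge 2$. The layers $G_k\setminus G_{k-1}$, $k=2,\dots,n$, partition $S_n\setminus\{\mathbf 1\}$. Let $\pi_0,\dots,\pi_{n!-1}$ be a genlex Hamiltonian listing of $S_n$, realised as a walk in a Cayley graph of $S_n$ (the generators used being the elements $\pi_i^{-1}\pi_{i+1}$, $0\le i<n!-1$). Then for every $k\in\{2,\dots,n\}$ the listing uses a generator from the layer $G_k\setminus G_{k-1}$; hence it uses at least $n-1$ distinct generators.
   Context: $S_n$ is the group of permutations of $\{1,\dots,n\}$, with one-line notation $\pi=\pi_1\cdots\pi_n$. Operations act on positions, on the right: $(\pi g)_i=\pi_{g(i)}$, i.e. $\pi g$ is the composition $i\mapsto\pi(g(i))$. For $1\le k\le n$, $G_k=\mathrm{Sym}\{1,\dots,k\}$ is the subgroup of permutations fixing each of $k+1,\dots,n$. A Hamiltonian listing of $S_n$ is a sequence $\pi_0,\dots,\pi_{n!-1}$ containing each element of $S_n$ exactly once. It is genlex when, for every $k$, the permutations agreeing in their last $n-k$ letters are consecutive, equivalently each left coset $\pi G_k$ occupies consecutive positions of the listing. *)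

(* Defs.v *)
From HB Require Import structures.
From mathcomp Require Import all_boot all_order all_fingroup.

Set Implicit Arguments.
Unset Strict Implicit.
Unset Printing Implicit Defensive.

(* The letters and positions 1, ..., n are represented by 'I_n = {0, ..., n-1}. *)

(* MathComp's product of permutations satisfies (s * t) i = t (s i); pmul is
   composition in the opposite order, so that the right factor acts on
   positions. *)
Definition pmul n (p g : 'S_n) : 'S_n := (g * p)%g.

Lemma pmulE n (p g : 'S_n) (i : 'I_n) : pmul p g i = p (g i).
Proof. exact: permM. Qed.

Definition G n k : {set 'S_n} := Sym [set i : 'I_n | i < k].

Definition layer n k : {set 'S_n} := G n k :\: G n k.-1.

Definition layers n : {set {set 'S_n}} :=
  [set layer n k | k : 'I_n.+1 & 2 <= k].

Definition hamiltonian n (s : (n`!).-tuple 'S_n) : Prop :=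
  forall p : 'S_n, count_mem p s = 1.

(* p and q have the same last n - k letters in one-line notation. *)
Definition agree_last n k (p q : 'S_n) : bool :=
  [forall i : 'I_n, (k <= i) ==> (p i == q i)].

Definition genlex n (s : (n`!).-tuple 'S_n) : Prop :=
  forall (k : nat) (p : 'S_n), 1 <= k <= n ->
  exists a m : nat, forall i : nat, i < n`! ->
    agree_last k p (nth 1%g s i) = (a <= i < a + m).

(* The elements p_i^-1 p_(i+1), 0 <= i < n! - 1. *)
Definition generators_used n (s : (n`!).-tuple 'S_n) : {set 'S_n} :=
  [set pmul (nth 1%g s i)^-1%g (nth 1%g s i.+1) | i : 'I_(n`!).-1].

(* Main.v *)
Require Import Defs.
From HB Require Import structures.
From mathcomp Require Import all_boot all_order all_fingroup.

Set Implicit Arguments.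
Unset Strict Implicit.
Unset Printing Implicit Defensive.

(** The filtration of the symmetric group by the subgroups [G n k] is governed
    by a single statistic: the depth of [u], the largest position (counted
    from 1) that [u] moves. Indeed [G n k] is the sublevel set [depth <= k],
    so each layer is a fibre of the depth ([in_layer]). Since the depth takes
    exactly the values 0 (at the identity only) and 2, ..., n, the layers are
    nonempty, pairwise disjoint, and cover everything but the identity.

    Let now a genlex listing be given and let [2 <= k <= n]. The listed
    elements of [G n k] occupy an interval of positions, and they do not all
    lie in one coset of [G n k.-1], because [G n k] contains both the identity
    and a transposition moving the position [k]. Hence, inside that interval,
    two consecutive entries lie in different cosets of [G n k.-1]
    ([consecutive_unrelated]); the generator between them belongs to [G n k]
    but not to [G n k.-1]. Generators found for different [k] have different
    depths, so there are at least [n - 1] of them. *)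

Definition depth n (u : 'S_n) : nat := \max_(i | u i != i) i.+1.

Lemma depth_leqP n (u : 'S_n) k :
  reflect (forall i : 'I_n, k <= i -> u i = i) (depth u <= k).
Proof.
apply: (iffP (bigmax_leqP _ _ _)) => [le_k i le_ki | fix_u i].
  by apply/eqP/negPn/negP => /le_k; rewrite ltnNge le_ki.
by rewrite ltnNge; apply: contra => /fix_u ->.
Qed.

Lemma in_G n k (u : 'S_n) : (u \in G n k) = (depth u <= k).
Proof.
rewrite inE; apply/subsetP/depth_leqP => [u_on i le_ki | fix_u i].
  apply/eqP/negPn/negP => /u_on.
  by rewrite inE ltnNge le_ki.
by rewrite !inE ltnNge; apply: contra => /fix_u ->.
Qed.

Lemma in_layer n k (u : 'S_n) : 0 < k -> (u \in layer n k) = (depth u == k).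
Proof.
case: k => // k _.
by rewrite inE !in_G /= -ltnNge eqn_leq andbC.
Qed.

Lemma depth_max n (u : 'S_n) : depth u <= n.
Proof. by apply/depth_leqP => i; rewrite leqNgt ltn_ord. Qed.

(** A permutation cannot move the first position alone, which is why the
    depth skips the value 1. *)
Lemma depth_le1 n (u : 'S_n) : (depth u <= 1) = (u == 1%g).
Proof.
apply/depth_leqP/eqP => [fix_u | -> i _]; last exact: perm1.
apply/permP => i; rewrite perm1.
have [le1i | ] := leqP 1 i; first exact: fix_u.
rewrite ltnS leqn0 => /eqP i0; apply: val_inj; rewrite /= i0.
(* A nonzero image of the first position would be fixed, so [u] would send
   both to the same value. *)
have [/fix_u /perm_inj -> // | ] := leqP 1 (u i).
by rewrite ltnS leqn0 => /eqP.
Qed.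

Lemma depth_tperm n (i j : 'I_n) : i < j -> depth (tperm i j) = j.+1.
Proof.
move=> lt_ij; apply/eqP; rewrite eqn_leq; apply/andP; split.
  by apply/depth_leqP => l lt_jl; rewrite tpermD // neq_ltn ?lt_jl ?(ltn_trans lt_ij).
rewrite ltnNge; apply/negP => /depth_leqP /(_ j (leqnn j)).
by rewrite tpermR => eq_ij; rewrite eq_ij ltnn in lt_ij.
Qed.

Lemma exists_depth n k : 2 <= k <= n -> exists u : 'S_n, depth u = k.
Proof.
case: k => [|[|k]] //= lt_kn.
by exists (tperm (Ordinal (ltnW lt_kn)) (Ordinal lt_kn)); rewrite depth_tperm.
Qed.

Lemma layer_inj n : {in [pred k | 2 <= k <= n] &, injective (layer n)}.
Proof.
move=> j k /[!inE] /[dup] j_n /andP[lt1j _] /andP[lt1k _] eq_jk.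
have [u depth_u] := exists_depth j_n.
apply/eqP; rewrite -depth_u -in_layer ?(ltnW lt1k) // -eq_jk.
by rewrite in_layer ?(ltnW lt1j) ?depth_u.
Qed.

Lemma layers_partition n : partition (layers n) [set~ 1%g].
Proof.
apply/and3P; split.
- apply/eqP/setP => u; rewrite !inE -depth_le1 -ltnNge.
  apply/bigcupP/idP => [[_ /imsetP[k /[!inE] le2k ->]] | lt1u].
    by rewrite in_layer ?(ltnW le2k) // => /eqP ->.
  exists (layer n (depth u)); last by rewrite in_layer ?(ltnW lt1u).
  by apply/imsetP; exists (Ordinal (depth_max u : depth u < n.+1)); rewrite ?inE.
- apply/trivIsetP => _ _ /imsetP[j /[!inE] le2j ->] /imsetP[k /[!inE] le2k ->].
  apply: contraR => /pred0Pn[u /= /andP[]].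
  by rewrite !in_layer ?(ltnW le2j) ?(ltnW le2k) // => /eqP <- /eqP <-.
- apply/imsetP => -[k /[!inE] le2k /setP].
  have [|u depth_u] := @exists_depth n k; first by rewrite le2k -ltnS ltn_ord.
  by move=> /(_ u); rewrite in_layer ?(ltnW le2k) // depth_u eqxx inE.
Qed.

Lemma agree_last_depth n k (p q : 'S_n) :
  agree_last k p q = (depth (pmul p^-1%g q) <= k).
Proof.
apply/forallP/depth_leqP => [agr i le_ki | fix_pq i].
  by have:= agr i; rewrite le_ki pmulE => /eqP <-; rewrite permK.
by apply/implyP => /fix_pq; rewrite pmulE => {1}<-; rewrite permKV.
Qed.

Lemma agree_last_refl n k : reflexive (@agree_last n k).
Proof. by move=> p; apply/forallP => i; rewrite eqxx implybT. Qed.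

Lemma agree_last_sym n k : symmetric (@agree_last n k).
Proof. by move=> p q; apply: eq_forallb => i; rewrite eq_sym. Qed.

Lemma agree_last_trans n k : transitive (@agree_last n k).
Proof.
move=> q p r /forallP pq /forallP qr; apply/forallP => i.
by apply/implyP => le_ki; rewrite (eqP (implyP (pq i) le_ki)) (implyP (qr i)).
Qed.

(** If every step from [i] to [j] stayed within a class of [e], then so would
    the whole stretch, by transitivity. *)
Lemma consecutive_unrelated T (e : rel T) (f : nat -> T) i j :
  reflexive e -> transitive e -> i <= j -> ~~ e (f i) (f j) ->
  exists2 l, i <= l < j & ~~ e (f l) (f l.+1).
Proof.
move=> e_refl e_trans; elim: j => [|j IHj].
  by rewrite leqn0 => /eqP ->; rewrite e_refl.
rewrite leq_eqVlt => /predU1P[-> | le_ij] unrel; first by rewrite e_refl in unrel.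
have [rel_ij | /(IHj le_ij)[l /andP[le_il lt_lj] unrel_l]] := boolP (e (f i) (f j)).
  exists j; first by rewrite -ltnS le_ij ltnSn.
  by apply: contra unrel; apply: e_trans.
by exists l => //; rewrite le_il ltnW.
Qed.

Lemma hamiltonian_index n (s : (n`!).-tuple 'S_n) p :
  hamiltonian s -> exists2 i, i < n`! & nth 1%g s i = p.
Proof.
move=> ham; have s_p: p \in s by rewrite -has_pred1 has_count ham.
by exists (index p s); rewrite ?nth_index // -[X in _ < X](size_tuple s) index_mem.
Qed.

Lemma genlex_uses_layer n (s : (n`!).-tuple 'S_n) k :
  hamiltonian s -> genlex s -> 2 <= k <= n ->
  exists2 g, g \in generators_used s & g \in layer n k.
Proof.
move=> ham lex /[dup] k_n /andP[lt1k le_kn].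
have [|a [m block]] := lex k 1%g; first by rewrite ltnW.
(* It suffices to find two positions of the block of [G n k], in increasing
   order, whose entries lie in different cosets of [G n k.-1]. *)
have step i j : i <= j -> j < n`! ->
    agree_last k 1%g (nth 1%g s i) -> agree_last k 1%g (nth 1%g s j) ->
    ~~ agree_last k.-1 (nth 1%g s i) (nth 1%g s j) ->
    exists2 g, g \in generators_used s & g \in layer n k.
  move=> le_ij lt_j; rewrite (block i) ?(block j) //; last exact: leq_ltn_trans lt_j.
  move=> /andP[le_ai _] /andP[_ lt_jam].
  have refl_e := @agree_last_refl n k.-1; have trans_e := @agree_last_trans n k.-1.
  case/(consecutive_unrelated refl_e trans_e le_ij) => l /andP[le_il lt_lj] unrel.
  have lt_l1 : l.+1 < n`! by apply: leq_ltn_trans lt_j.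
  have lt_l : l < (n`!).-1 by rewrite -ltnS prednK // fact_gt0.
  exists (pmul (nth 1%g s l)^-1%g (nth 1%g s l.+1)).
    by apply/imsetP; exists (Ordinal lt_l).
  have in_block x : i <= x <= j -> agree_last k 1%g (nth 1%g s x).
    case/andP=> le_ix le_xj; rewrite block ?(leq_ltn_trans le_xj) //.
    by rewrite (leq_trans le_ai) // (leq_ltn_trans le_xj).
  rewrite inE !in_G -!agree_last_depth unrel /=.
  apply: (@agree_last_trans _ _ 1%g).
    by rewrite agree_last_sym in_block // le_il ltnW.
  by rewrite in_block // lt_lj (leq_trans le_il).
have [t depth_t] := exists_depth k_n.
have [i lt_i si] := hamiltonian_index 1%g ham.
have [j lt_j sj] := hamiltonian_index t ham.
have agree1t l : agree_last l 1%g t = (k <= l).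
  by rewrite agree_last_depth /pmul invg1 mulg1 depth_t.
have agree_i : agree_last k 1%g (nth 1%g s i) by rewrite si agree_last_refl.
have agree_j : agree_last k 1%g (nth 1%g s j) by rewrite sj agree1t.
have disagree : ~~ agree_last k.-1 (nth 1%g s i) (nth 1%g s j).
  by rewrite si sj agree1t -ltnNge prednK ?(ltnW lt1k).
have [le_ij | /ltnW le_ji] := leqP i j; first exact: step disagree.
by apply: (step j i); rewrite // agree_last_sym.
Qed.

Theorem lemma2p2 (n : nat) (hn : 2 <= n) :
  [/\ partition (layers n) [set~ 1%g],
      {in [pred k | 2 <= k <= n] &, injective (layer n)}
    & forall s : (n`!).-tuple 'S_n, hamiltonian s -> genlex s ->
        (forall k, 2 <= k <= n ->
           exists2 g, g \in generators_used s & g \in layer n k)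
        /\ n - 1 <= #|generators_used s| ].
Proof.
split; [exact: layers_partition | exact: layer_inj | move=> s ham lex].
have uses k := @genlex_uses_layer n s k ham lex.
split=> //.
(* The depths of the generators used include all of 2, ..., n. *)
rewrite -(size_iota 2 (n - 1)) cardE -(size_map (@depth n)).
apply: uniq_leq_size (iota_uniq _ _) _ => k.
rewrite mem_iota => /andP[le2k lt_k].
have [|g used_g] := uses k.
  by rewrite le2k -ltnS (leq_trans lt_k) // add2n subn1 prednK // ltnW.
rewrite in_layer ?(ltnW le2k) // => /eqP <-.
by apply: map_f; rewrite mem_enum.
Qed.
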